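(* The equational consequence relation $\models_\Delta$ has the Beth definability property: for every set of variables $\overline{x}$, variable $y\notin\overline{x}$, and theory $\Sigma(\overline{x},y)$, if $\Sigma$ implicitly defines $y$ over $\overline{x}$, then $\Sigma$ explicitly defines $y$ over $\overline{x}$.
   Context: An MV-algebra is an algebra $(A,\oplus,\neg,0)$ of type $(2,1,0)$ such that $(A,\oplus,0)$ is a commutative monoid, $\neg\neg a=a$, $a\oplus\neg 0=\neg 0$, and $\neg(\neg a\oplus b)\oplus b=\neg(\neg b\oplus a)\oplus a$. Derived operations: $1:=\neg 0$, $a\odot b:=\neg(\neg a\oplus\neg b)$, $a\ominus b:=a\odot\neg b$, $a\vee b:=\neg(\neg a\oplus b)\oplus b$ (join of a lattice order $\le$), $d(a,b):=(a\ominus b)\oplus(b\ominus a)$. Let $\mathcal{L}=\{\delta,\oplus,\neg,0\}$ of type $(\omega,2,1,0)$; $\tfrac12(x):=\delta(x,0,0,\dots)$. A $\delta$-algebra is an $\mathcal{L}$-algebra whose MV-reduct is an MV-algebra and satisfying for all $x,y,\vec x,\vec y$: (i) $d(\delta(\vec x),\delta(x_1,0,0,\dots))=\delta(0,x_2,x_3,\dots)$; (ii) $\tfrac12(\delta(\vec x))=\delta(\tfrac12(x_1),\tfrac12(x_2),\dots)$; (iii) $\delta(x,x,\dots)=x$; (iv) $\delta(0,\vec x)=\tfrac12(\delta(\vec x))$; (v) $\delta(\vec x)\le\delta(x_1\oplus y_1,x_2\oplus y_2,\dots)$; (vi) $\tfrac12(x\ominus y)=\tfrac12(x)\ominus\tfrac12(y)$.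 Terms are elements of the absolutely free $\mathcal{L}$-algebra over a set of variables; equations are pairs $s\approx t$ of terms; theories are sets of equations. For an assignment $f$ into an $\mathcal{L}$-algebra $A$, $A,f\models\Sigma$ means $\bar f(s)=\bar f(t)$ for all $s\approx t\in\Sigma$, $\bar f$ the homomorphic extension to terms. $\Sigma\models_\Delta\sigma$ means every assignment into every $\delta$-algebra satisfying $\Sigma$ satisfies $\sigma$. For a theory $\Sigma(\overline{x},y)$ and a variable $z$, $\Sigma(\overline{x},z)$ is obtained by replacing $y$ by $z$. $\Sigma$ implicitly defines $y$ over $\overline{x}$ if $\Sigma(\overline{x},y)\cup\Sigma(\overline{x},z)\models_\Delta y\approx z$ for every variable $z$; $\Sigma$ explicitly defines $y$ over $\overline{x}$ if there is a term $s_y(\overline{x})$ in the variables $\overline{x}$ with $\Sigma(\overline{x},y)\models_\Delta y\approx s_y$.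
   Formalization: It is assumed that some variable lies outside x̄ ∪ {y} (otherwise false: with only x, y available, Σ = {y⊙y≈y, x≈¬x} implicitly but not explicitly defines y); variables have decidable equality, and all variables of Σ lie in x̄ ∪ {y}. *)

(* Defs.v *)
From mathcomp Require Import all_boot.
Set Implicit Arguments.
Unset Strict Implicit.
Unset Printing Implicit Defensive.

(** Terms of the language L = {delta, (+), neg, 0} of type (omega,2,1,0):
    the absolutely free L-algebra over a type V of variables.
    [TDelta ts] is delta(ts 0, ts 1, ts 2, ...) (so x_1 is [ts 0]). *)
Inductive term (V : Type) : Type :=
  | TVar : V -> term V
  | TDelta : (nat -> term V) -> term V
  | TOplus : term V -> term V -> term V
  | TNeg : term V -> term V
  | TZero : term V.
Arguments TZero {V}.

Definition equation (V : Type) := (term V * term V)%type.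
Definition theory (V : Type) := equation V -> Prop.

Inductive occurs (V : Type) (v : V) : term V -> Prop :=
  | occ_var : occurs v (TVar v)
  | occ_delta : forall ts n, occurs v (ts n) -> occurs v (TDelta ts)
  | occ_oplusl : forall s t, occurs v s -> occurs v (TOplus s t)
  | occ_oplusr : forall s t, occurs v t -> occurs v (TOplus s t)
  | occ_neg : forall s, occurs v s -> occurs v (TNeg s).

Fixpoint rename (V : Type) (g : V -> V) (t : term V) : term V :=
  match t with
  | TVar v => TVar (g v)
  | TDelta ts => TDelta (fun n => rename g (ts n))
  | TOplus s u => TOplus (rename g s) (rename g u)
  | TNeg s => TNeg (rename g s)
  | TZero => TZero
  end.

Definition subst_var (V : eqType) (y z : V) (v : V) : V :=
  if v == y then z else v.

Definition theory_subst (V : eqType) (S : theory V) (y z : V) : theory V :=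
  fun e => exists s t, S (s, t) /\
    e = (rename (subst_var y z) s, rename (subst_var y z) t).

Record Lalg := {
  carrier :> Type;
  dlt : (nat -> carrier) -> carrier;
  oplus : carrier -> carrier -> carrier;
  neg : carrier -> carrier;
  zero : carrier
}.
Arguments dlt {l} _.
Arguments oplus {l} _ _.
Arguments neg {l} _.
Arguments zero {l}.

Section Derived.
Variable A : Lalg.
Definition one : A := neg (@zero A).
Definition odot (a b : A) : A := neg (oplus (neg a) (neg b)).
Definition ominus (a b : A) : A := odot a (neg b).
Definition join (a b : A) : A := oplus (neg (oplus (neg a) b)) b.
Definition leA (a b : A) : Prop := join a b = b.
Definition dist (a b : A) : A := oplus (ominus a b) (ominus b a).
Definition half (a : A) : A := dlt (fun n => if n is 0 then a else zero).
End Derived.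

Definition is_MV (A : Lalg) : Prop :=
  (forall a b c : A, oplus a (oplus b c) = oplus (oplus a b) c) /\
  (forall a b : A, oplus a b = oplus b a) /\
  (forall a : A, oplus a (@zero A) = a) /\
  (forall a : A, neg (neg a) = a) /\
  (forall a : A, oplus a (neg (@zero A)) = neg (@zero A)) /\
  (forall a b : A, oplus (neg (oplus (neg a) b)) b = oplus (neg (oplus (neg b) a)) a).

Definition is_delta_algebra (A : Lalg) : Prop :=
  is_MV A /\
  (forall xs : nat -> A,
      dist (dlt xs) (dlt (fun n => if n is 0 then xs 0 else zero))
      = dlt (fun n => if n is 0 then zero else xs n)) /\
  (forall xs : nat -> A, half (dlt xs) = dlt (fun n => half (xs n))) /\
  (forall x : A, dlt (fun _ => x) = x) /\
  (forall xs : nat -> A,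
      dlt (fun n => if n is k.+1 then xs k else zero) = half (dlt xs)) /\
  (forall xs ys : nat -> A, leA (dlt xs) (dlt (fun n => oplus (xs n) (ys n)))) /\
  (forall x y : A, half (ominus x y) = ominus (half x) (half y)).

Record deltaAlgebra := {
  dalg :> Lalg;
  dalg_ax : is_delta_algebra dalg
}.

Fixpoint eval (V : Type) (A : Lalg) (f : V -> A) (t : term V) : A :=
  match t with
  | TVar v => f v
  | TDelta ts => dlt (fun n => eval f (ts n))
  | TOplus s u => oplus (eval f s) (eval f u)
  | TNeg s => neg (eval f s)
  | TZero => zero
  end.

Definition satisfies (V : Type) (A : Lalg) (f : V -> A) (S : theory V) : Prop :=
  forall s t, S (s, t) -> eval f s = eval f t.

Definition entails (V : Type) (S : theory V) (e : equation V) : Prop :=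
  forall (A : deltaAlgebra) (f : V -> A), satisfies f S -> eval f e.1 = eval f e.2.

Definition theory_union (V : Type) (S T : theory V) : theory V :=
  fun e => S e \/ T e.

Definition implicitly_defines (V : eqType) (S : theory V) (y : V) : Prop :=
  forall z : V, entails (theory_union S (theory_subst S y z)) (TVar y, TVar z).

Definition explicitly_defines (V : eqType) (X : V -> Prop) (S : theory V) (y : V) : Prop :=
  exists s : term V, (forall v, occurs v s -> X v) /\ entails S (TVar y, s).

(* Main.v *)
From Stdlib Require Import Reals Lra Classical ClassicalEpsilon FunctionalExtensionality.
From Stdlib Require Import ProofIrrelevance.
From Coquelicot Require Import Coquelicot.
From mathcomp Require Import all_boot.
From mathcomp Require Import classical_sets.
Require Import Defs.
Set Implicit Arguments.
Unset Strict Implicit.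
Unset Printing Implicit Defensive.

(** Every δ-algebra has enough homomorphisms to [0,1]: infinitesimals vanish
    because of δ, a maximal proper ideal is prime, and modulo a prime ideal each
    element is located by the dyadic multiples of [1], which yields a
    homomorphism.  It therefore suffices to find a term defining [y] in all
    models [p] of the theory in [0,1].  Implicit definability says that such
    models are separated by a variable in [X] whenever they disagree on [y], so
    that any two of them admit a term over [X] taking the value of [y] at both.
    As in the lattice form of the Stone-Weierstrass theorem, compactness turns these terms
    into uniform approximations of [y]; compactness is the existence of
    homomorphisms from the power of [0,1] indexed by the models, whose restrictions
    to terms are again models.  Finally a uniform limit of terms is a term: δ
    sums the successive binary corrections. *)

Local Open Scope nat_scope.
Local Delimit Scope R_scope with Re.

Local Notation "a ⊕ b" := (oplus a b) (at level 50, left associativity).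
Local Notation "a ⊖ b" := (ominus a b) (at level 50, left associativity).

(** * MV-algebra arithmetic *)

Section MVAlgebra.
Variable A : deltaAlgebra.
Implicit Types a b c d x y z : A.

Lemma oplusA a b c : a ⊕ (b ⊕ c) = a ⊕ b ⊕ c.
Proof. by case: (dalg_ax A) => -[H _] _. Qed.

Lemma oplusC a b : a ⊕ b = b ⊕ a.
Proof. by case: (dalg_ax A) => -[_ [H _]] _. Qed.

Lemma oplus0 a : a ⊕ zero = a.
Proof. by case: (dalg_ax A) => -[_ [_ [H _]]] _. Qed.

Lemma negK a : neg (neg a) = a.
Proof. by case: (dalg_ax A) => -[_ [_ [_ [H _]]]] _. Qed.

Lemma oplus1 a : a ⊕ one A = one A.
Proof. by case: (dalg_ax A) => -[_ [_ [_ [_ [H _]]]]] _. Qed.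

Lemma joinC a b : join a b = join b a.
Proof. by case: (dalg_ax A) => -[_ [_ [_ [_ [_ H]]]]] _; exact: H. Qed.

Lemma oplus0l a : zero ⊕ a = a.
Proof. by rewrite oplusC oplus0. Qed.

Lemma neg1 : neg (one A) = zero.
Proof. exact: negK. Qed.

Lemma oplusNl a : neg a ⊕ a = one A.
Proof. by have := joinC (one A) a; rewrite /join neg1 oplus0l oplus1. Qed.

Lemma oplusACA a b c d : a ⊕ b ⊕ (c ⊕ d) = a ⊕ c ⊕ (b ⊕ d).
Proof. by rewrite -!oplusA (oplusA b) (oplusC b c) !oplusA. Qed.

Lemma ominusE a b : a ⊖ b = neg (neg a ⊕ b).
Proof. by rewrite /ominus /odot negK. Qed.

(** The MV-order in implicational form; [mleP] turns it into divisibility, from which transitivity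
    and monotonicity are immediate. *)
Definition mle a b : Prop := neg a ⊕ b = one A.

Lemma mleP a b : mle a b <-> exists c, b = a ⊕ c.
Proof.
split=> [h|[c ->]]; last by rewrite /mle oplusA oplusNl oplusC oplus1.
exists (b ⊖ a); have := joinC a b.
by rewrite /join h neg1 oplus0l ominusE oplusC.
Qed.

Lemma mle_refl a : mle a a.
Proof. exact: oplusNl. Qed.

Lemma mle_trans b a c : mle a b -> mle b c -> mle a c.
Proof.
move=> /mleP [u ->] /mleP [v ->]; apply/mleP.
by exists (u ⊕ v); rewrite oplusA.
Qed.

Lemma mle_anti a b : mle a b -> mle b a -> a = b.
Proof.
by move=> h k; have := joinC a b; rewrite /join h k !neg1 !oplus0l.
Qed.

Lemma mle_oplus a b c d : mle a b -> mle c d -> mle (a ⊕ c) (b ⊕ d).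
Proof.
move=> /mleP [u ->] /mleP [v ->]; apply/mleP.
by exists (u ⊕ v); rewrite oplusACA.
Qed.

Lemma mle_addl a b : mle a (b ⊕ a).
Proof. by apply/mleP; exists b; rewrite oplusC. Qed.

Lemma mle0 a : mle zero a.
Proof. by apply/mleP; exists a; rewrite oplus0l. Qed.

Lemma mle1 a : mle a (one A).
Proof. exact: oplus1. Qed.

Lemma mle_neg a b : mle a b -> mle (neg b) (neg a).
Proof. by rewrite /mle negK oplusC. Qed.

Lemma mle_le0 a : mle a zero -> a = zero.
Proof. by move=> h; apply: mle_anti => //; exact: mle0. Qed.

(** Up to associativity both sides unfold to the same equation. Inequalities about ⊖ are reduced to
    ⊕ through this adjunction. *)
Lemma residuation a b c : mle (a ⊖ b) c <-> mle a (b ⊕ c).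
Proof. by rewrite /mle ominusE negK oplusA. Qed.

Lemma mle_ominus0 a b : a ⊖ b = zero <-> mle a b.
Proof.
rewrite -{2}(oplus0 b) -residuation.
by split=> [->|/mle_le0//]; exact: mle_refl.
Qed.

Lemma mle_oplus_ominus a b : mle a (b ⊕ (a ⊖ b)).
Proof. by apply/residuation; exact: mle_refl. Qed.

Lemma ominus_le a b : mle (a ⊖ b) a.
Proof. by apply/residuation; exact: mle_addl. Qed.

Lemma ominusK a b : mle a b -> (b ⊖ a) ⊕ a = b.
Proof.
by move=> h; have := joinC b a; rewrite /join h neg1 oplus0l ominusE.
Qed.

Lemma join_lub a b c : mle a c -> mle b c -> mle (join a b) c.
Proof.
move=> ac bc; rewrite -(ominusK bc) /join -ominusE; apply: mle_oplus (mle_refl _).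
by apply/residuation; rewrite oplusC ominusK.
Qed.

Lemma ominusB a b : mle b a -> a ⊖ (a ⊖ b) = b.
Proof.
move=> h; have := ominusK (mle_neg h); rewrite !ominusE !negK => e.
by rewrite -[RHS]negK -e (oplusC b) (oplusC _ (neg a)).
Qed.

Lemma oplusK a b : mle a (neg b) -> (a ⊕ b) ⊖ b = a.
Proof.
move=> /mle_neg; rewrite negK => /ominusK.
by rewrite !ominusE negK => e; rewrite -[RHS]negK -e.
Qed.

Lemma ominusDl a b c : a ⊖ (b ⊕ c) = a ⊖ b ⊖ c.
Proof. by rewrite !ominusE negK oplusA. Qed.

Lemma ominus0 a : a ⊖ zero = a.
Proof. by rewrite ominusE oplus0 negK. Qed.

Lemma ominus1l a : one A ⊖ a = neg a.
Proof. by rewrite ominusE neg1 oplus0l. Qed.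

Lemma ominus_negneg a b : neg b ⊖ neg a = a ⊖ b.
Proof. by rewrite !ominusE negK oplusC. Qed.

Lemma ominusxx a : a ⊖ a = zero.
Proof. by apply/mle_ominus0; exact: mle_refl. Qed.

Lemma dist_ge a b : mle b a -> dist a b = a ⊖ b.
Proof. by move=> /mle_ominus0 h; rewrite /dist h oplus0. Qed.

(** Expresses that the meet is zero, through lower bounds only. *)
Definition mdisjoint a b : Prop := forall z, mle z a -> mle z b -> z = zero.

(** The element [m] is the meet of [a] and [b]. A common lower bound [z] of the two differences has
    [z ⊕ m] below both [a] and [b], hence below [m]; cancelling [m] leaves zero. *)
Lemma mdisjoint_ominus a b : mdisjoint (a ⊖ b) (b ⊖ a).
Proof.
pose m := a ⊖ (a ⊖ b).
have ma : mle m a by exact: ominus_le.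
have mb : mle m b.
  by apply/residuation; rewrite oplusC; exact: mle_oplus_ominus.
have am : mle (a ⊖ b) (a ⊖ m).
  by rewrite ominusB; [exact: mle_refl | exact: ominus_le].
have bm : mle (b ⊖ a) (b ⊖ m).
  apply/residuation; apply: (mle_trans (mle_oplus_ominus b m)).
  exact: mle_oplus ma (mle_refl _).
move=> z za zb.
have zma : mle (z ⊕ m) a.
  rewrite -[X in mle _ X](ominusK ma).
  by apply: mle_oplus (mle_refl _); exact: mle_trans za am.
have zmb : mle (z ⊕ m) b.
  rewrite -[X in mle _ X](ominusK mb).
  by apply: mle_oplus (mle_refl _); exact: mle_trans zb bm.
have zm : mle (z ⊕ m) m.
  have := join_lub (mle_neg zmb) (mle_neg zma).
  by move=> /mle_neg; rewrite negK /m ominusE /join negK ominusE (oplusC b) (oplusC _ (neg a)).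
(* Cancelling [m] requires that the sum [z ⊕ m] is not truncated. *)
have zn : mle z (neg m).
  apply: (mle_trans za); apply: (mle_trans am); rewrite ominusE.
  by apply: mle_neg; exact: mle_addl.
by rewrite -(oplusK zn); apply/mle_ominus0.
Qed.
End MVAlgebra.

(** * Halving and the Archimedean property *)

Section DeltaAlgebra.
Variable A : deltaAlgebra.
Implicit Types (a b x y : A) (xs ys : nat -> A).

Lemma dlt_const x : dlt (fun _ => x) = x.
Proof. by case: (dalg_ax A) => _ [_ [_ [H _]]]; exact: H. Qed.

Lemma half_dlt xs : half (dlt xs) = dlt (fun n => half (xs n)).
Proof. by case: (dalg_ax A) => _ [_ [H _]]; exact: H. Qed.

Lemma half_ominus x y : half (x ⊖ y) = half x ⊖ half y.
Proof. by case: (dalg_ax A) => _ [_ [_ [_ [_ [_ H]]]]]; exact: H. Qed.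

(** Axiom (v) applied to the increments [ys n ⊖ xs n]. *)
Lemma dlt_mono xs ys : (forall n, mle (xs n) (ys n)) -> mle (dlt xs) (dlt ys).
Proof.
move=> h; have -> : ys = fun n => xs n ⊕ (ys n ⊖ xs n).
  by apply: functional_extensionality => n; rewrite oplusC ominusK.
have [_ [_ [_ [_ [_ [H _]]]]]] := dalg_ax A.
by rewrite -H joinC; exact: mle_addl.
Qed.

Lemma half_le_dlt xs : mle (half (xs 0)) (dlt xs).
Proof. by apply: dlt_mono => -[|n]; [exact: mle_refl | exact: mle0]. Qed.

(** Axioms (i) and (iv) combined, the distance being a plain difference by [half_le_dlt]. This is
    the recursion that characterises δ. *)
Lemma dlt_tail xs : dlt xs ⊖ half (xs 0) = half (dlt (fun n => xs n.+1)).
Proof.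
have [_ [H1 [_ [_ [H4 _]]]]] := dalg_ax A.
rewrite -dist_ge; last exact: half_le_dlt.
by rewrite H1 -H4; congr dlt; apply: functional_extensionality => -[].
Qed.

Lemma ominus_half x : x ⊖ half x = half x.
Proof. by have := dlt_tail (fun _ => x); rewrite !dlt_const. Qed.

Lemma half_le x : mle (half x) x.
Proof. by rewrite -[in half x]ominus_half -ominus_half; exact: ominus_le. Qed.

Lemma half_oplus x : half x ⊕ half x = x.
Proof. by rewrite -{1}ominus_half ominusK //; exact: half_le. Qed.

Lemma half_le_half1 x : mle (half x) (half (one A)).
Proof. by apply: dlt_mono => -[|n]; [exact: mle1 | exact: mle0]. Qed.

Lemma neg_half1 : neg (half (one A)) = half (one A).
Proof. by rewrite -ominus1l ominus_half. Qed.

Lemma mle_half x y : mle (half x) (half y) -> mle x y.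
Proof.
move=> /mle_ominus0; rewrite -half_ominus => h.
by apply/mle_ominus0; rewrite -(half_oplus (x ⊖ y)) h oplus0.
Qed.

(** Halving commutes with ⊖ but not with ⊕, so the double is written as a difference from [one A];
    the bound on [a] makes the last double subtraction exact. *)
Lemma half_double a : mle a (half (one A)) -> half (a ⊕ a) = a.
Proof.
move=> ha; have -> : a ⊕ a = one A ⊖ (one A ⊖ a ⊖ a).
  by rewrite -ominusDl !ominus1l negK.
by rewrite !half_ominus -ominusDl half_oplus ominusB.
Qed.

(** The dyadic unit 2^-n of [A]. *)
Definition eps n : A := iter n (@half A) (one A).

(* With [x = δ(2a, 4a, 8a, ...)], halving the tail of [x] gives back [x], so
   that [x ⊖ a = x]. *)
Lemma archimedean a : (forall n, mle a (eps n)) -> a = zero.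
Proof.
move=> ha; pose dbl n := iter n (fun x => x ⊕ x) a.
(* All doublings stay infinitesimal, so none is truncated and [half] undoes each of them. *)
have hd n k : mle (dbl n) (eps k).
  elim: n k => [|n IH] k //; apply: mle_half.
  by rewrite /= half_double; [exact: (IH k.+1) | exact: (IH 1)].
have hh n : half (dbl n.+1) = dbl n by apply: half_double; exact: (hd n 1).
pose x := dlt (fun n => dbl n.+1).
have ax : mle a x by rewrite -[a](hh 0); exact: (half_le_dlt (fun n => dbl n.+1)).
have e : x ⊖ a = x.
  have := dlt_tail (fun n => dbl n.+1); rewrite hh half_dlt => ->.
  by congr dlt; apply: functional_extensionality => n; exact: hh.
by rewrite -(ominusB ax) e ominusxx.
Qed.

Definition nmul k a : A := iter k (oplus a) zero.

Lemma nmulD k l a : nmul (k + l) a = nmul k a ⊕ nmul l a.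
Proof.
elim: k => [|k IH]; first by rewrite oplus0l.
by rewrite addSn /= IH oplusA.
Qed.

Lemma nmul_half k a : nmul (k + k) (half a) = nmul k a.
Proof.
by elim: k => [|k IH] //; rewrite addnS addSn /= IH oplusA half_oplus.
Qed.

Lemma nmul_eps k n m : nmul k (eps n) = nmul (k * 2 ^ m) (eps (n + m)).
Proof.
elim: m => [|m IH]; first by rewrite muln1 addn0.
by rewrite expnS mulnCA mul2n -addnn addnS /= nmul_half.
Qed.

Lemma nmul_eps_full n : nmul (2 ^ n) (eps n) = one A.
Proof. by rewrite -[2 ^ n]mul1n -(nmul_eps 1 0) /= oplus0. Qed.

Lemma nmul_eps_top k n : 2 ^ n <= k -> nmul k (eps n) = one A.
Proof. by move=> /subnK <-; rewrite nmulD nmul_eps_full oplus1. Qed.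

Lemma mle_nmul k l a : k <= l -> mle (nmul k a) (nmul l a).
Proof. by move=> /subnK <-; rewrite nmulD; exact: mle_addl. Qed.

(** Since [half e] is [e ⊖ half e], its negation is [neg e ⊕ half e]: the old count doubles and
    gains one new unit. *)
Lemma neg_eps n : neg (eps n) = nmul (2 ^ n).-1 (eps n).
Proof.
elim: n => [|n IH]; first exact: neg1.
have -> : (2 ^ n.+1).-1 = ((2 ^ n).-1 + (2 ^ n).-1).+1.
  by rewrite expnS mul2n -addnn; have := expn_gt0 2 n; case: (2 ^ n) => // m _; rewrite addnS.
by rewrite /= nmul_half -IH -{1}ominus_half ominusE negK oplusC.
Qed.

Lemma neg_nmul_eps k n : k <= 2 ^ n -> neg (nmul k (eps n)) = nmul (2 ^ n - k) (eps n).
Proof.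
elim: k => [_|k IH kn]; first by rewrite subn0 nmul_eps_full.
rewrite /= -ominus1l oplusC ominusDl ominus1l IH 1?ltnW //.
(* [oplusK] asks that the remaining multiple lie below [neg (eps n)], that is, have at most 2^n - 1
   units. *)
rewrite -(subnSK kn) /= oplusC oplusK // neg_eps.
by apply: mle_nmul; rewrite -subn1 leq_sub2l.
Qed.

End DeltaAlgebra.

(** * Ideals *)

Section Ideals.
Variable A : deltaAlgebra.
Implicit Types (a b x y z : A) (G K : A -> Prop).

(** Generation is inductive, so that one can argue by induction on how an element is obtained from
    the generators. *)
Inductive ideal G : A -> Prop :=
  | ideal0 : ideal G zero
  | ideal_gen a : G a -> ideal G a
  | ideal_le a b : mle a b -> ideal G b -> ideal G a
  | ideal_add a b : ideal G a -> ideal G b -> ideal G (a ⊕ b).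

Lemma ideal_mono G K a : (forall x, G x -> K x) -> ideal G a -> ideal K a.
Proof.
move=> GK; elim=> [|x /GK|x y xy _|x y _ hx _ hy].
- exact: ideal0.
- exact: ideal_gen.
- exact: ideal_le.
- exact: ideal_add.
Qed.

(** Induction on membership of [b], for all [z] below it: below the generator [x] only zero is
    disjoint from [x], and a [z] below a sum splits into parts below the summands. For [b] equal to
    [one A]: if adding [x] makes the ideal improper, everything disjoint from [x] was already in
    it. *)
Lemma ideal_mdisjoint K x b : ideal (fun a => a = x \/ K a) b ->
  forall z, mle z b -> mdisjoint z x -> ideal K z.
Proof.
elim=> [z /mle_le0 -> _|a [->|Ka] z za zx|a c ac _ IH z za|a c _ IHa _ IHc z zac zx].
- exact: ideal0.
- by rewrite (zx z (mle_refl z) za); exact: ideal0.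
- exact: ideal_le za (ideal_gen Ka).
- by apply: IH; exact: mle_trans za ac.
have sub w : mle w z -> mdisjoint w x.
  by move=> wz u uw; apply: zx; exact: mle_trans uw wz.
apply: ideal_le (mle_oplus_ominus z (z ⊖ a)) _; apply: ideal_add.
- by apply: IHc; [exact/residuation | apply: sub; exact: ominus_le].
- apply: IHa; last by apply: sub; exact: ominus_le.
  by apply/residuation; rewrite oplusC; exact: mle_oplus_ominus.
Qed.

(** A maximal proper ideal works: if it misses [a ⊖ b], adding that element generates [one A], and
    [b ⊖ a], being disjoint from it, must already belong. *)
Lemma prime_ideal G : ~ ideal G (one A) ->
  exists K, [/\ forall a, G a -> K a, ~ ideal K (one A) &
    forall a b, ideal K (a ⊖ b) \/ ideal K (b ⊖ a)].
Proof.
move=> G1.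
(* Adjoining [G] inside [P] makes the empty chain harmless: its union satisfies [P] by [G1]. *)
pose P (I : set A) := ~ ideal (fun a => I a \/ G a) (one A).
have [F FP Ftot|I [PI Imax]] := @Zorn_bigcup A P.
  (* A derivation uses finitely many members of the chain, hence at most one; the left case uses
     none. *)
  have H a : ideal (fun a => (\bigcup_(X in F) X)%classic a \/ G a) a ->
      ideal G a \/ exists2 X, F X & ideal (fun a => X a \/ G a) a.
    elim=> [|x [[X FX Xx]|Gx]|x y xy _|x y _ hx _ hy].
    - by left; exact: ideal0.
    - by right; exists X => //; apply: ideal_gen; left.
    - by left; exact: ideal_gen.
    - by case=> [h|[X FX h]]; [left|right; exists X => //]; exact: ideal_le xy h.
    - case: hx hy => [hx|[X FX hx]] [hy|[Y FY hy]].
      + by left; exact: ideal_add.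
      + right; exists Y => //; apply: ideal_add => //.
        by apply: ideal_mono hx => ?; right.
      + right; exists X => //; apply: ideal_add => //.
        by apply: ideal_mono hy => ?; right.
      + have [XY|YX] := Ftot _ _ FX FY; right; [exists Y => //|exists X => //].
          apply: ideal_add => //; apply: ideal_mono hx => u [/XY|]; tauto.
        apply: ideal_add => //; apply: ideal_mono hy => u [/YX|]; tauto.
  by move=> /H [//|[X /FP]].
pose K a := I a \/ G a.
exists K; split=> // [a|a b]; first by right.
have [h|h] := classic (ideal K (a ⊖ b)); first by left.
right.
have Ih : ~ I (a ⊖ b) by move=> Iab; apply: h; apply: ideal_gen; left.
pose J := [set x | x = a ⊖ b \/ I x]%classic.
have : ~ P J.
  apply: Imax; split=> [|JI]; first by move=> u; right.
  by apply: Ih; apply: JI; left.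
move=> /NNPP J1; apply: (@ideal_mdisjoint K (a ⊖ b) (one A)).
- by apply: ideal_mono J1 => u [[]|]; rewrite /K; tauto.
- exact: mle1.
- exact: mdisjoint_ominus.
Qed.

End Ideals.

(** * The unit interval and its powers *)

Section Series.
Local Open Scope R_scope.

(** The standard δ on [0,1]: with indices from 0 the weights are 1/2, 1/4, ... and sum to 1. *)
Definition dsum (x : nat -> R) : R := Series (fun n => x n * (/ 2) ^ n.+1).

Lemma halfpow_gt0 n : 0 < (/ 2) ^ n.
Proof. by apply: pow_lt; lra. Qed.

Lemma is_lim_halfpow : is_lim_seq (fun n => (/ 2) ^ n) 0.
Proof. by apply: is_lim_seq_geom; rewrite Rabs_pos_eq; lra. Qed.

(** Here [r n] plays the value of the n-th tail. The partial sums telescope to [r 0] minus [r n.+1]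
    times a vanishing power of 1/2. *)
Lemma dsum_unique (r x : nat -> R) : (forall n, 0 <= r n <= 1) ->
  (forall n, r n = x n / 2 + r n.+1 / 2) -> dsum x = r 0%N.
Proof.
move=> r01 hr; apply: is_series_unique.
have hs n : sum_n (fun n => x n * (/ 2) ^ n.+1) n = r 0%N - r n.+1 * (/ 2) ^ n.+1.
  elim: n => [|n IH]; first by rewrite sum_O (hr 0%N) /=; lra.
  rewrite sum_Sn IH (hr n.+1) /plus /=; set t := (/ 2) ^ n; lra.
change (is_lim_seq (sum_n (fun n => x n * (/ 2) ^ n.+1)) (Rbar.Finite (r 0%N))).
apply: (is_lim_seq_le_le (fun n => r 0%N - (/ 2) ^ n.+1) _ (fun n => r 0%N)).
- move=> n; rewrite hs; have := halfpow_gt0 n.+1; have := r01 n.+1.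
  by set t := (/ 2) ^ n.+1 => *; nra.
- rewrite -[X in is_lim_seq _ (Rbar.Finite X)]Rminus_0_r.
  apply: is_lim_seq_minus'; first exact: is_lim_seq_const.
  exact/(is_lim_seq_incr_1 (fun n => (/ 2) ^ n))/is_lim_halfpow.
- exact: is_lim_seq_const.
Qed.

Lemma ex_dsum x : (forall n, 0 <= x n <= 1) -> ex_series (fun n => x n * (/ 2) ^ n.+1).
Proof.
move=> x01; apply: (@ex_series_le R_AbsRing R_CompleteNormedModule _ (fun n => (/ 2) ^ n)).
  move=> n; rewrite /norm /= /abs /=.
  have := halfpow_gt0 n; have := x01 n; set t := (/ 2) ^ n => ? ?.
  by rewrite Rabs_pos_eq; nra.
by apply: ex_series_geom; rewrite Rabs_pos_eq; lra.
Qed.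

Lemma dsum_ext x x' : (forall n, x n = x' n) -> dsum x = dsum x'.
Proof. by move=> h; apply: Series_ext => n; rewrite h. Qed.

Lemma dsum_le x x' : (forall n, 0 <= x n <= x' n) -> (forall n, x' n <= 1) ->
  dsum x <= dsum x'.
Proof.
move=> h h1; apply: Series_le => [n|].
  have := halfpow_gt0 n.+1; have := h n; set t := (/ 2) ^ n.+1; nra.
by apply: ex_dsum => n; have := h n; have := h1 n; lra.
Qed.

Lemma dsum_const c : 0 <= c <= 1 -> dsum (fun _ => c) = c.
Proof. by move=> hc; apply: (@dsum_unique (fun _ => c)) => // n; lra. Qed.

Lemma dsum01 x : (forall n, 0 <= x n <= 1) -> 0 <= dsum x <= 1.
Proof.
move=> h; rewrite -[X in X <= _](@dsum_const 0); last lra.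
rewrite -[X in _ /\ _ <= X](@dsum_const 1); last lra.
by split; apply: dsum_le => n; have := h n; lra.
Qed.

Lemma dsum_scal c x : dsum (fun n => c * x n) = c * dsum x.
Proof.
by rewrite /dsum -Series_scal_l; apply: Series_ext => n; rewrite Rmult_assoc.
Qed.

Lemma dsum_tail x : (forall n, 0 <= x n <= 1) ->
  dsum x = x 0%N / 2 + dsum (fun n => x n.+1) / 2.
Proof.
move=> h; rewrite {1}/dsum Series_incr_1; last exact: ex_dsum.
have -> : Series (fun k => x k.+1 * (/ 2) ^ k.+2) = / 2 * dsum (fun n => x n.+1).
  rewrite /dsum -Series_scal_l; apply: Series_ext => n /=; ring.
by rewrite /=; lra.
Qed.

End Series.

(** * The standard δ-algebra on [0,1] *)

Section UnitInterval.
Local Open Scope R_scope.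

Record unitR := UnitR { uval :> R; uvalP : 0 <= uval <= 1 }.

Lemma uval_inj (a b : unitR) : a = b :> R -> a = b.
Proof.
case: a b => [a ha] [b hb] /= e; subst b; congr UnitR; exact: proof_irrelevance.
Qed.

Lemma uzeroP : 0 <= 0 <= 1. Proof. lra. Qed.
Lemma unegP (a : unitR) : 0 <= 1 - a <= 1. Proof. by case: a => a /=; lra. Qed.
Lemma uoplusP (a b : unitR) : 0 <= Rmin 1 (a + b) <= 1.
Proof. by case: a b => [a ?] [b ?] /=; rewrite /Rmin; case: Rle_dec; lra. Qed.
Lemma udltP (xs : nat -> unitR) : 0 <= dsum (fun n => xs n) <= 1.
Proof. by apply: dsum01 => n; exact: uvalP. Qed.

Definition unitL : Lalg :=
  {| carrier := unitR; dlt := fun xs => UnitR (udltP xs);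
     oplus := fun a b => UnitR (uoplusP a b); neg := fun a => UnitR (unegP a);
     zero := UnitR uzeroP |}.

Implicit Types a b : unitL.

Lemma uoplusE a b : uval (a ⊕ b) = Rmin 1 (a + b). Proof. by []. Qed.
Lemma unegE a : uval (neg a) = 1 - a. Proof. by []. Qed.
Lemma uzeroE : uval (zero : unitL) = 0. Proof. by []. Qed.
Lemma udltE (xs : nat -> unitL) : uval (dlt xs) = dsum (fun n => uval (xs n)).
Proof. by []. Qed.

Lemma uominusE a b : uval (a ⊖ b) = Rmax 0 (a - b).
Proof.
rewrite /ominus /odot !(unegE, uoplusE).
by case: a b => [a ?] [b ?] /=; rewrite /Rmin /Rmax; do 2?case: Rle_dec; lra.
Qed.

Lemma ujoinE a b : uval (join a b) = Rmax a b.
Proof.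
rewrite /join !(unegE, uoplusE).
by case: a b => [a ?] [b ?] /=; rewrite /Rmin /Rmax; do 3?case: Rle_dec; lra.
Qed.

Lemma uhalfE a : uval (half a) = a / 2.
Proof.
rewrite udltE dsum_tail => [|n]; last exact: uvalP.
by rewrite dsum_const //=; lra.
Qed.

Lemma udistE a b : uval (dist a b) = Rabs (a - b).
Proof.
rewrite /dist uoplusE !uominusE; case: a b => [a ?] [b ?] /=.
by rewrite /Rabs /Rmin /Rmax; case: Rcase_abs; do 3?case: Rle_dec; lra.
Qed.

Lemma unit_is_delta_algebra : is_delta_algebra unitL.
Proof.
have ext (xs ys : nat -> unitL) : (forall n, xs n = ys n :> R) -> dlt xs = dlt ys.
  by move=> h; apply: uval_inj; exact: dsum_ext.
split; [repeat split|split; [|split; [|split; [|split; [|split]]]]].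
- move=> a b c; apply: uval_inj; rewrite !uoplusE.
  by case: a b c => [a ?] [b ?] [c ?] /=; rewrite /Rmin; do 4?case: Rle_dec; lra.
- by move=> a b; apply: uval_inj; rewrite !uoplusE Rplus_comm.
- move=> a; apply: uval_inj; rewrite !uoplusE uzeroE.
  by case: a => [a ?] /=; rewrite /Rmin; case: Rle_dec; lra.
- by move=> a; apply: uval_inj; rewrite !unegE; lra.
- move=> a; apply: uval_inj; rewrite !(uoplusE, unegE) uzeroE.
  by case: a => [a ?] /=; rewrite /Rmin; case: Rle_dec; lra.
- move=> a b; apply: uval_inj; rewrite -!/(join _ _) !ujoinE; exact: Rmax_comm.
- move=> xs; apply: uval_inj; rewrite udistE -/(half _) uhalfE !udltE.
  have h n : 0 <= uval (xs n) <= 1 by exact: uvalP.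
  rewrite [in LHS]dsum_tail // [RHS]dsum_tail => [|[|n] /=]; [|lra|exact: h].
  have := udltP (fun n => xs n.+1) => /= ?; rewrite Rabs_pos_eq; lra.
- move=> xs; apply: uval_inj; rewrite uhalfE !udltE /Rdiv Rmult_comm -dsum_scal.
  by apply: dsum_ext => n; rewrite uhalfE; lra.
- by move=> x; apply: uval_inj; rewrite udltE dsum_const //; exact: uvalP.
- move=> xs; apply: uval_inj; rewrite uhalfE !udltE dsum_tail => [|[|n] /=].
  + by rewrite uzeroE; lra.
  + lra.
  + exact: uvalP.
- move=> xs ys; rewrite /leA; apply: uval_inj; rewrite ujoinE Rmax_right //.
  apply: dsum_le => n; last exact: (proj2 (uvalP _)).
  rewrite uoplusE; case: (xs n) (ys n) => [a ?] [b ?] /=.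
  by rewrite /Rmin; case: Rle_dec; lra.
- move=> a b; apply: uval_inj; rewrite !(uhalfE, uominusE).
  by rewrite /Rmax; do 2?case: Rle_dec; lra.
Qed.

Definition unitA : deltaAlgebra := Build_deltaAlgebra unit_is_delta_algebra.

End UnitInterval.

(** * Powers of a δ-algebra *)

Section Power.
Variables (T : Type) (A : deltaAlgebra).

Definition powL : Lalg :=
  {| carrier := T -> A; dlt := fun xs t => dlt (fun n => xs n t);
     oplus := fun a b t => a t ⊕ b t; neg := fun a t => neg (a t);
     zero := fun _ => zero |}.

Lemma pow_is_delta_algebra : is_delta_algebra powL.
Proof.
have [[a1 [a2 [a3 [a4 [a5 a6]]]]] [h1 [h2 [h3 [h4 [h5 h6]]]]]] := dalg_ax A.
(* The match inside [half] keeps this pointwise identity from holding by conversion. *)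
have hhalf (a : powL) t : half a t = half (a t).
  by rewrite /half /=; congr dlt; apply: functional_extensionality => -[].
split; [repeat split|split; [|split; [|split; [|split; [|split]]]]];
  do ?[by move=> *; apply: functional_extensionality => t /=].
- move=> xs; apply: functional_extensionality => t.
  transitivity (dist (dlt (fun n => xs n t)) (half (xs 0 t))).
    by rewrite -hhalf.
  rewrite [LHS](h1 (fun n => xs n t)).
  by congr dlt; apply: functional_extensionality => -[].
- move=> xs; apply: functional_extensionality => t.
  rewrite [LHS](hhalf (dlt xs)) [LHS]h2.
  by congr dlt; apply: functional_extensionality => n; symmetry; exact: hhalf.
- move=> xs; apply: functional_extensionality => t.
  transitivity (half (dlt (fun n => xs n t))); last by rewrite [RHS]hhalf.
  rewrite -h4.
  by congr dlt; apply: functional_extensionality => -[].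
- by move=> xs ys; apply: functional_extensionality => t; exact: (h5 (fun n => xs n t)).
- move=> x y; apply: functional_extensionality => t.
  transitivity (half (x t) ⊖ half (y t)); last by rewrite -!hhalf.
  by rewrite [LHS](hhalf (x ⊖ y)) -h6.
Qed.

Definition powA : deltaAlgebra := Build_deltaAlgebra pow_is_delta_algebra.

End Power.

(** * Homomorphisms to the unit interval *)

Record is_hom (A B : Lalg) (h : A -> B) : Prop := IsHom {
  hom_dlt : forall xs, h (dlt xs) = dlt (fun n => h (xs n));
  hom_oplus : forall a b, h (a ⊕ b) = h a ⊕ h b;
  hom_neg : forall a, h (neg a) = neg (h a);
  hom_zero : h zero = zero }.

Lemma hom_ominus (A B : Lalg) (h : A -> B) a b : is_hom h -> h (a ⊖ b) = h a ⊖ h b.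
Proof. by case=> _ hD hN _; rewrite /ominus /odot !(hN, hD). Qed.

Lemma hom_half (A B : Lalg) (h : A -> B) a : is_hom h -> h (half a) = half (h a).
Proof.
case=> hd _ _ h0; rewrite /half hd.
by congr dlt; apply: functional_extensionality => -[].
Qed.

Lemma hom_eval (V : Type) (A B : Lalg) (h : A -> B) (f : V -> A) t :
  is_hom h -> h (eval f t) = eval (fun v => h (f v)) t.
Proof.
case=> hd hD hN h0; elim: t => [v|ts IH|s IHs t IHt|s IHs|] //=.
- by rewrite hd; congr dlt; apply: functional_extensionality => n; exact: IH.
- by rewrite hD IHs IHt.
- by rewrite hN IHs.
Qed.

(** * Dyadic cuts modulo a prime ideal *)

Section PrimeHom.
Variables (A : deltaAlgebra) (K : A -> Prop).
Hypothesis K1 : ~ ideal K (one A).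
Hypothesis Ktotal : forall a b, ideal K (a ⊖ b) \/ ideal K (b ⊖ a).
Implicit Types a b c d x y : A.

(** The order of the quotient by the ideal, total by [Ktotal]; the quotient itself is not formed. *)
Let qle a b := ideal K (a ⊖ b).

Lemma qle_mle a b : mle a b -> qle a b.
Proof. by move=> /mle_ominus0 h; rewrite /qle h; exact: ideal0. Qed.

Lemma qle_trans b a c : qle a b -> qle b c -> qle a c.
Proof.
move=> ab bc; apply: ideal_le (ideal_add bc ab); apply/residuation.
rewrite oplusA; apply: (mle_trans (mle_oplus_ominus a b)).
by apply: mle_oplus (mle_refl _); exact: mle_oplus_ominus.
Qed.

Lemma qle_oplus a b c d : qle a b -> qle c d -> qle (a ⊕ c) (b ⊕ d).
Proof.
move=> ab cd; apply: ideal_le (ideal_add ab cd); apply/residuation.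
by rewrite oplusACA; apply: mle_oplus; exact: mle_oplus_ominus.
Qed.

Lemma qle_neg a b : qle a b -> qle (neg b) (neg a).
Proof. by rewrite /qle ominus_negneg. Qed.

(** Pass to a common unit [e]. If the inequality failed, L+1 units would lie below L units in the
    quotient; completing the left side to [one A] gives [one A] below [neg e], so [e] and all its
    multiples vanish, against [K1]. *)
Lemma dyadic_le k n l m : k <= 2 ^ n ->
  qle (nmul k (eps A n)) (nmul l (eps A m)) -> k * 2 ^ m <= l * 2 ^ n.
Proof.
move=> kn; rewrite (nmul_eps A k n m) (nmul_eps A l m n) (addnC m n).
set N := n + m; set L := l * _; set e := eps A N; move=> h.
rewrite leqNgt; apply/negP => Lk; apply: K1.
have LN : L < 2 ^ N.
  by apply: leq_trans Lk _; rewrite expnD leq_mul2r kn orbT.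
have {}h : qle (nmul L.+1 e) (nmul L e) := qle_trans (qle_mle (mle_nmul e Lk)) h.
have e0 : qle e zero.
  have := qle_oplus h (qle_mle (mle_refl (nmul (2 ^ N - L.+1) e))).
  rewrite -!nmulD subnKC // nmul_eps_full.
  have -> : L + (2 ^ N - L.+1) = (2 ^ N).-1 by rewrite -{2}(subnKC LN).
  by rewrite -neg_eps => /qle_neg; rewrite negK neg1.
have ne0 j : qle (nmul j e) zero.
  elim: j => [|j IH]; first exact/qle_mle/mle_refl.
  by rewrite -[zero]oplus0; exact: qle_oplus.
by have := ne0 (2 ^ N); rewrite nmul_eps_full /qle ominus0.
Qed.

(** Climb the multiples of [eps A n], deciding each comparison by totality; the first one not below
    [x] closes the bracket. If none is found, the last bracket ends at [one A]. *)
Lemma dyadic_approx x n : exists2 k, k < 2 ^ n &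
  qle (nmul k (eps A n)) x /\ qle x (nmul k.+1 (eps A n)).
Proof.
have H j : j <= 2 ^ n -> qle (nmul j (eps A n)) x \/ exists2 k, k < 2 ^ n &
    qle (nmul k (eps A n)) x /\ qle x (nmul k.+1 (eps A n)).
  elim: j => [|j IH] jn; first by left; exact/qle_mle/mle0.
  have [jx|] := IH (ltnW jn); last by right.
  have [|xj] := Ktotal (nmul j.+1 (eps A n)) x; first by left.
  by right; exists j.
have [|h|//] := H (2 ^ n); first exact: leqnn.
exists (2 ^ n).-1; rewrite ?prednK ?expn_gt0 //; split.
  by apply: qle_trans h; exact/qle_mle/mle_nmul/leq_pred.
by rewrite nmul_eps_full; exact/qle_mle/mle1.
Qed.

Local Open Scope R_scope.

Definition dyad (k n : nat) : R := INR k * (/ 2) ^ n.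

Lemma INR_expn n : INR (2 ^ n)%N * (/ 2) ^ n = 1.
Proof.
elim: n => [|n IH]; first by rewrite expn0 /=; lra.
by rewrite expnS -multE mult_INR [INR 2]/=; rewrite /=; nra.
Qed.

Lemma dyad_le k n l m : (k * 2 ^ m <= l * 2 ^ n)%N -> dyad k n <= dyad l m.
Proof.
move=> /leP /le_INR; rewrite -!multE !mult_INR /dyad.
have := INR_expn n; have := INR_expn m.
have := halfpow_gt0 n; have := halfpow_gt0 m.
set a := (/ 2) ^ n; set b := (/ 2) ^ m; set u := INR (2 ^ n); set v := INR (2 ^ m).
move=> b0 a0 bv au h.
have -> : INR k * a = INR k * v * (a * b) by rewrite -[LHS]Rmult_1_r -bv; ring.
have -> : INR l * b = INR l * u * (a * b) by rewrite -[LHS]Rmult_1_r -au; ring.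
by apply: Rmult_le_compat_r => //; nra.
Qed.

(** The real is the supremum of the dyadics below [x]. The bound on [k] is there because multiples
    saturate at [one A] while [dyad] keeps growing. *)
Lemma cut_exists x : exists r, forall k n,
  ((k <= 2 ^ n)%N -> qle (nmul k (eps A n)) x -> dyad k n <= r) /\
  (qle x (nmul k (eps A n)) -> r <= dyad k n).
Proof.
pose E r := exists k n, [/\ (k <= 2 ^ n)%N, qle (nmul k (eps A n)) x & r = dyad k n].
have ub l m : qle x (nmul l (eps A m)) -> is_upper_bound E (dyad l m).
  move=> xl _ [k [n [kn kx ->]]]; apply: dyad_le; apply: dyadic_le => //.
  exact: qle_trans kx xl.
have [||r [r1 r2]] := completeness E.
- by exists (dyad 1 0); apply: ub; apply: qle_mle; rewrite /= oplus0; exact: mle1.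
- by exists (dyad 0 0), 0%N, 0%N; split=> //; exact/qle_mle/mle0.
exists r => k n; split=> [kn kx|/ub]; last exact: r2.
by apply: r1; exists k, n.
Qed.

Definition cut x : R := proj1_sig (constructive_indefinite_description _ (cut_exists x)).

Lemma cut_le x k n : qle x (nmul k (eps A n)) -> cut x <= dyad k n.
Proof. by rewrite /cut; case: constructive_indefinite_description => r /= /(_ k n) []. Qed.

Lemma cut_ge x k n : qle (nmul k (eps A n)) x -> Rmin 1 (dyad k n) <= cut x.
Proof.
rewrite /cut; case: constructive_indefinite_description => r /= h kx.
have [kn|/ltnW kn] := leqP k (2 ^ n).
  exact: Rle_trans (Rmin_r _ _) (proj1 (h k n) kn kx).
apply: Rle_trans (Rmin_l _ _) _; rewrite -(INR_expn n); apply: (proj1 (h _ n)) => //.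
by rewrite nmul_eps_full -(nmul_eps_top A kn).
Qed.

Lemma cutP x : 0 <= cut x <= 1.
Proof.
split.
  have := @cut_ge x 0 0 (qle_mle (mle0 x)); rewrite /dyad Rmin_right /=; lra.
have := @cut_le x 1 0; rewrite /dyad /= oplus0 => h.
by have := h (qle_mle (mle1 x)); lra.
Qed.

Lemma eq_of_dyadic (a b c : R) : (forall n, Rabs (a - b) <= c * (/ 2) ^ n) -> a = b.
Proof.
move=> h; apply: cond_eq => e e0.
have c0 : 0 < Rabs c + 1 by have := Rabs_pos c; lra.
have [||N HN] := pow_lt_1_zero (/ 2) _ (e / (Rabs c + 1)).
- by rewrite Rabs_pos_eq; lra.
- exact: Rdiv_lt_0_compat.
apply: Rle_lt_trans (h N) _.
have := HN N (Nat.le_refl N); have t0 := halfpow_gt0 N.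
rewrite Rabs_pos_eq; last lra.
move=> /(Rmult_lt_compat_r _ _ _ c0); rewrite /Rdiv Rmult_assoc Rinv_l; last lra.
by have := Rle_abs c; nra.
Qed.

Lemma cut_approx x n : exists k, [/\ (k < 2 ^ n)%N, qle (nmul k (eps A n)) x,
  qle x (nmul k.+1 (eps A n)) & dyad k n <= cut x <= dyad k n + (/ 2) ^ n].
Proof.
have [k kn [h1 h2]] := dyadic_approx x n; exists k; split=> //.
have := cut_le h2; have := cut_ge h1; rewrite /dyad S_INR.
have : dyad k n <= dyad 1 0 by apply: dyad_le; rewrite muln1 mul1n ltnW.
rewrite /dyad /=; set t := (/ 2) ^ n => ?; rewrite Rmin_right; lra.
Qed.

(** Negation reflects the level-n bracket of [x], so both sides differ by at most two units 2^-n,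
    for every n. *)
Lemma cut_neg x : cut (neg x) = 1 - cut x.
Proof.
apply: (@eq_of_dyadic _ _ 2) => n.
have [k [kn h1 h2 h3]] := cut_approx x n.
have := qle_neg h1; rewrite neg_nmul_eps 1?ltnW // => /cut_le.
have := qle_neg h2; rewrite neg_nmul_eps // => /cut_ge.
rewrite /dyad -!minusE (minus_INR _ k.+1); last exact/leP.
rewrite (minus_INR _ k); last exact/leP/ltnW.
rewrite !Rmult_minus_distr_r INR_expn S_INR; move: h3; rewrite /dyad.
have := halfpow_gt0 n; have := pos_INR k.
set t := (/ 2) ^ n; set u := INR k => u0 t0 h3.
rewrite Rmin_right; last by nra.
by move=> *; apply: Rabs_le; lra.
Qed.

(** Adding the level-n brackets traps the sum between k+l and k+l+2 units, up to truncation. *)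
Lemma cut_oplus x y : cut (x ⊕ y) = Rmin 1 (cut x + cut y).
Proof.
apply: (@eq_of_dyadic _ _ 2) => n.
have [k [kn h1 h2 h3]] := cut_approx x n.
have [l [ln g1 g2 g3]] := cut_approx y n.
have := qle_oplus h1 g1; have := qle_oplus h2 g2; rewrite -!nmulD.
move=> /cut_le + /cut_ge; have := cutP (x ⊕ y); move: h3 g3.
rewrite /dyad -!plusE !plus_INR !S_INR; have := halfpow_gt0 n.
set t := (/ 2) ^ n; rewrite !Rmult_plus_distr_r.
by rewrite /Rmin; do 2?case: Rle_dec => ?; move=> *; apply: Rabs_le; lra.
Qed.

Lemma cut_ideal x : ideal K x -> cut x = 0.
Proof.
move=> h; have := cutP x; have := @cut_le x 0 0; rewrite /dyad /= Rmult_0_l.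
have q : qle x zero by rewrite /qle ominus0.
by move=> /(_ q); lra.
Qed.

End PrimeHom.

(* Any MV-homomorphism to [0,1] preserves [δ]: the tail identity gives
   [h (δ xs) = h (xs 0) / 2 + h (δ (tail xs)) / 2], which determines it. *)
Lemma MV_hom_dlt (A : deltaAlgebra) (h : A -> unitA) :
  (forall a b, h (a ⊕ b) = h a ⊕ h b) -> (forall a, h (neg a) = neg (h a)) ->
  forall xs, h (dlt xs) = dlt (fun n => h (xs n)).
Proof.
move=> hD hN xs.
have h1 : uval (h (one A)) = 1%Re.
  rewrite -(oplusNl zero) hD hN uoplusE unegE Rmin_left; lra.
have hmono a b : mle a b -> (h a <= h b)%Re.
  move=> ab; move: h1; rewrite -ab hD hN uoplusE unegE.
  by rewrite /Rmin; case: Rle_dec; lra.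
(* [half (one A)] is its own negation, hence has value 1/2; this bounds the value of every half, so
   the sums below are not truncated. *)
have hhalf1 : uval (h (half (one A))) = (/ 2)%Re.
  have := congr1 uval (hN (half (one A))); rewrite neg_half1 unegE; lra.
have hhalf a : uval (h (half a)) = (h a / 2)%Re.
  have := congr1 uval (hD (half a) (half a)); rewrite half_oplus uoplusE.
  have := hmono _ _ (half_le_half1 a); rewrite hhalf1 => ?.
  rewrite Rmin_right; lra.
apply: uval_inj; rewrite udltE.
symmetry; apply: (@dsum_unique (fun n => uval (h (dlt (fun m => xs (n + m)%N))))).
- by move=> n; exact: uvalP.
move=> n; set ys := fun m => xs (n + m).
rewrite -{1}(ominusK (half_le_dlt ys)) hD uoplusE dlt_tail !hhalf /ys addn0.
have -> : (fun m => xs (n + m.+1)) = (fun m => xs (n.+1 + m)).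
  by apply: functional_extensionality => m; rewrite addnS.
have := uvalP (h (xs n)); have := uvalP (h (dlt (fun m => xs (n.+1 + m)))).
move=> *; rewrite Rmin_right; lra.
Qed.

Theorem exists_hom (A : deltaAlgebra) (G : A -> Prop) : ~ ideal G (one A) ->
  exists h : A -> unitA, is_hom h /\ forall a, G a -> h a = zero.
Proof.
move=> /prime_ideal [K [GK K1 Ktot]].
pose h a : unitA := UnitR (cutP K1 a).
have hD a b : h (a ⊕ b) = h a ⊕ h b by apply: uval_inj; exact: cut_oplus.
have hN a : h (neg a) = neg (h a) by apply: uval_inj; exact: cut_neg.
have h0 a : ideal K a -> h a = zero by move=> Ka; apply: uval_inj; exact: cut_ideal.
exists h; split=> [|a /GK Ka]; last exact/h0/ideal_gen.
split=> //; last exact/h0/ideal0.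
exact: MV_hom_dlt.
Qed.

(* If [a] is not below [ε = 2^-k], the ideal generated by [ε ⊖ a] is proper,
   being disjoint from [a ⊖ ε], and a homomorphism killing it has [h a >= ε]. *)
Theorem semisimple (A : deltaAlgebra) (a : A) : a <> zero ->
  exists2 h : A -> unitA, is_hom h & h a <> zero.
Proof.
move=> a0.
have [k ak] : exists k, ~ mle a (eps A k).
  by apply: not_all_ex_not => /archimedean.
have [|h [hom hG]] := @exists_hom A (fun b => b = eps A k ⊖ a).
  move=> h; apply: ak; apply/mle_ominus0.
  (* The ideal without generators contains only zero. *)
  have G0 : ideal (fun _ => False) (a ⊖ eps A k).
    apply: (@ideal_mdisjoint A _ (eps A k ⊖ a) (one A)).
    - by apply: ideal_mono h => ? ->; left.
    - exact: mle1.
    - exact: mdisjoint_ominus.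
  elim: G0 => //= [b c bc _ c0|b c _ -> _ ->]; last exact: oplus0.
  by apply: mle_le0; rewrite -c0.
exists h => // ha.
have := hG _ (erefl _); rewrite hom_ominus // ha.
have heps n : uval (h (eps A n)) = ((/ 2) ^ n)%Re.
  elim: n => [|n IH] /=.
    by rewrite (hom_neg hom) (hom_zero hom) unegE uzeroE; lra.
  by rewrite hom_half // uhalfE IH; lra.
move=> /(congr1 uval); rewrite uominusE uzeroE heps.
by have := halfpow_gt0 k; rewrite /Rmax; case: Rle_dec; lra.
Qed.

(** * Terms over the unit interval *)

Section Terms.
Variable V : Type.
Implicit Types (s t : term V) (p q : V -> unitA).

Lemma eval_ext (A : Lalg) (f g : V -> A) t :
  (forall v, occurs v t -> f v = g v) -> eval f t = eval g t.
Proof.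
elim: t => [v|ts IH|s IHs t IHt|s IHs|] //= h.
- by apply: h; exact: occ_var.
- congr dlt; apply: functional_extensionality => n.
  by apply: IH => v hv; apply: h; exact: occ_delta hv.
- by rewrite IHs ?IHt // => v hv; apply: h; [exact: occ_oplusr | exact: occ_oplusl].
- by rewrite IHs // => v hv; apply: h; exact: occ_neg.
Qed.

Lemma eval_rename (A : Lalg) (f : V -> A) g t :
  eval f (rename g t) = eval (fun v => f (g v)) t.
Proof.
elim: t => [v|ts IH|s IHs t IHt|s IHs|] //=.
- by congr dlt; apply: functional_extensionality => n; exact: IH.
- by rewrite IHs IHt.
- by rewrite IHs.
Qed.

(** These terms copy the bodies of [ominus] and [join], double negation included, so that evaluation
    gives those operations by conversion. *)
Definition tominus s t := TNeg (TOplus (TNeg s) (TNeg (TNeg t))).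
Definition tjoin s t := TOplus (TNeg (TOplus (TNeg s) t)) t.
Definition tmeet s t := TNeg (tjoin (TNeg s) (TNeg t)).

Local Open Scope R_scope.

Lemma eval_oplus p s t : uval (eval p (TOplus s t)) = Rmin 1 (eval p s + eval p t).
Proof. by []. Qed.

Lemma eval_neg p t : uval (eval p (TNeg t)) = 1 - eval p t.
Proof. by []. Qed.

Lemma eval_tominus p s t : uval (eval p (tominus s t)) = Rmax 0 (eval p s - eval p t).
Proof. exact: uominusE. Qed.

Lemma eval_tjoin p s t : uval (eval p (tjoin s t)) = Rmax (eval p s) (eval p t).
Proof. exact: ujoinE. Qed.

Lemma eval_tmeet p s t : uval (eval p (tmeet s t)) = Rmin (eval p s) (eval p t).
Proof.
change (1 - eval p (tjoin (TNeg s) (TNeg t)) = Rmin (eval p s) (eval p t)).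
rewrite eval_tjoin !eval_neg.
by rewrite /Rmin /Rmax; do 2?case: Rle_dec; lra.
Qed.

Definition tbigjoin (ts : seq (term V)) := foldr tjoin TZero ts.
Definition tbigmeet (ts : seq (term V)) := foldr tmeet (TNeg TZero) ts.

Lemma eval_tbigjoin_ge p t ts : List.In t ts -> eval p t <= eval p (tbigjoin ts).
Proof.
elim: ts => [[]|u ts IH] [->|/IH {}IH]; rewrite eval_tjoin; first exact: Rmax_l.
exact: Rle_trans IH (Rmax_r _ _).
Qed.

Lemma eval_tbigjoin_le p r ts : 0 <= r ->
  (forall t, List.In t ts -> eval p t <= r) -> eval p (tbigjoin ts) <= r.
Proof.
move=> r0; elim: ts => [|t ts IH] h //; rewrite eval_tjoin.
apply: Rmax_lub; first by apply: h; left.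
by apply: IH => u hu; apply: h; right.
Qed.

Lemma eval_tbigmeet_le p t ts : List.In t ts -> eval p (tbigmeet ts) <= eval p t.
Proof.
elim: ts => [[]|u ts IH] [->|/IH {}IH]; rewrite eval_tmeet; first exact: Rmin_l.
exact: Rle_trans (Rmin_r _ _) IH.
Qed.

Lemma eval_tbigmeet_ge p r ts : r <= 1 ->
  (forall t, List.In t ts -> r <= eval p t) -> r <= eval p (tbigmeet ts).
Proof.
move=> r1; elim: ts => [|t ts IH] h; first by rewrite eval_neg /=; lra.
rewrite eval_tmeet; apply: Rmin_glb; first by apply: h; left.
by apply: IH => u hu; apply: h; right.
Qed.

Variable X : V -> Prop.

Definition over t : Prop := forall v, occurs v t -> X v.

Lemma over_var v : X v -> over (TVar v).
Proof. by move=> Xv u hu; inversion hu; subst. Qed.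

Lemma over_delta ts : (forall n, over (ts n)) -> over (TDelta ts).
Proof. by move=> h u hu; inversion hu; subst; apply: h; eassumption. Qed.

Lemma over_oplus s t : over s -> over t -> over (TOplus s t).
Proof. by move=> hs ht u hu; inversion hu; subst; [exact: hs|exact: ht]. Qed.

Lemma over_neg t : over t -> over (TNeg t).
Proof. by move=> ht u hu; inversion hu; subst; exact: ht. Qed.

Lemma over_zero : over TZero.
Proof. by move=> u hu; inversion hu. Qed.

Lemma over_tominus s t : over s -> over t -> over (tominus s t).
Proof. by move=> hs ht; do ?[apply: over_oplus || apply: over_neg]. Qed.

Lemma over_tjoin s t : over s -> over t -> over (tjoin s t).
Proof. by move=> hs ht; do ?[apply: over_oplus || apply: over_neg]. Qed.

Lemma over_tmeet s t : over s -> over t -> over (tmeet s t).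
Proof. by move=> hs ht; apply/over_neg/over_tjoin; exact: over_neg. Qed.

Lemma over_tbigjoin ts : (forall t, List.In t ts -> over t) -> over (tbigjoin ts).
Proof.
elim: ts => [|t ts IH] h; first exact: over_zero.
by apply: over_tjoin; [apply: h; left | apply: IH => u hu; apply: h; right].
Qed.

Lemma over_tbigmeet ts : (forall t, List.In t ts -> over t) -> over (tbigmeet ts).
Proof.
elim: ts => [|t ts IH] h; first exact/over_neg/over_zero.
by apply: over_tmeet; [apply: h; left | apply: IH => u hu; apply: h; right].
Qed.

(* [δ] along the binary digits of [r] is multiplication by [r]. *)
Lemma scale_term r t : 0 <= r <= 1 -> over t ->
  exists2 s, over s & forall p, uval (eval p s) = r * eval p t.
Proof.
move=> r01 ot.
pose digit a : bool := if Rle_dec (/ 2) a then true else false.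
pose step a := if digit a then 2 * a - 1 else 2 * a.
pose r_ n := iter n step r.
have r_01 n : 0 <= r_ n <= 1.
  elim: n => [|n IH] //=; rewrite -/(r_ n) /step /digit.
  by case: Rle_dec => /= ?; lra.
exists (TDelta (fun n => if digit (r_ n) then t else TZero)).
  by apply: over_delta => n; case: (digit (r_ n)) => //; exact: over_zero.
move=> p; have e01 := uvalP (eval p t).
transitivity (dsum (fun n => if digit (r_ n) then uval (eval p t) else 0)).
  by apply: dsum_ext => n; case: (digit (r_ n)).
(* The tail after n digits is the remainder [r_ n] times the value of [t]. *)
apply: (@dsum_unique (fun n => r_ n * eval p t)) => n.
  by have := r_01 n; nra.
by rewrite [r_ n.+1]/= -/(r_ n) /step; case: (digit (r_ n)); lra.
Qed.

Lemma const_term r : 0 <= r <= 1 ->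
  exists2 s, over s & forall p, uval (eval p s) = r.
Proof.
move=> r01; have [||s os hs] := @scale_term r (TNeg TZero) => //.
  exact/over_neg/over_zero.
by exists s => // p; rewrite hs /=; lra.
Qed.

Lemma eval_nmul p n t :
  uval (eval p (iter n (TOplus t) TZero)) = Rmin 1 (INR n * eval p t).
Proof.
elim: n => [|n IH]; first by rewrite Rmult_0_l Rmin_right //=; lra.
rewrite iterS eval_oplus IH S_INR; have := uvalP (eval p t).
by rewrite /Rmin; do 3?case: Rle_dec; lra.
Qed.

(** Subtract the constant [p x] from the variable [x], then add the result to itself often enough to
    saturate at [q]. *)
Lemma separate p q x : X x -> p x < q x ->
  exists2 t, over t & uval (eval p t) = 0 /\ uval (eval q t) = 1.
Proof.
move=> Xx pq; have [c oc hc] := const_term (uvalP (p x)).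
have [n hn] := INR_unbounded (/ (q x - p x)).
have hn1 : 1 <= INR n * (q x - p x).
  rewrite -(Rinv_l (q x - p x)); last lra.
  by apply: Rmult_le_compat_r; lra.
exists (iter n (TOplus (tominus (TVar x) c)) TZero).
  elim: n {hn hn1} => [|n IH]; first exact: over_zero.
  by apply: over_oplus IH; apply: over_tominus oc; exact: over_var.
rewrite !eval_nmul !eval_tominus !hc /=; split.
  by rewrite Rmax_left ?Rmult_0_r ?Rmin_right; lra.
by rewrite Rmax_right ?Rmin_left; lra.
Qed.

(** With [t] going from 0 to 1, take a + (b - a)t if a ≤ b, and b + (a - b)(1 - t) otherwise. *)
Lemma interpolate_lt p q x (a b : unitA) : X x -> p x < q x ->
  exists2 t, over t & uval (eval p t) = a /\ uval (eval q t) = b.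
Proof.
move=> Xx /(separate Xx) [t ot [tp tq]].
have := uvalP a; have := uvalP b => hb ha.
have [ab|ba] := Rle_dec a b.
- have [c oc hc] := const_term ha.
  have [||s os hs] := @scale_term (b - a) t => //; first lra.
  exists (TOplus c s); first exact: over_oplus.
  by rewrite !eval_oplus !hc !hs tp tq !Rmin_right; lra.
- have [c oc hc] := const_term hb.
  have [||s os hs] := @scale_term (a - b) (TNeg t) => //; first lra.
    exact: over_neg.
  exists (TOplus c s); first exact: over_oplus.
  by rewrite !eval_oplus !hc !hs /= tp tq !Rmin_right; lra.
Qed.

Lemma interpolate p q (a b : unitA) : (exists2 x, X x & p x <> q x) ->
  exists2 t, over t & uval (eval p t) = a /\ uval (eval q t) = b.
Proof.
move=> [x Xx pq].
have [lt|[/uval_inj //|gt]] := Rtotal_order (p x) (q x).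
  exact: interpolate_lt lt.
by have [t ot []] := interpolate_lt b a Xx gt; exists t.
Qed.

End Terms.

(** * Compactness and definability *)

Section Compactness.
Variables (V : Type) (S : theory V).
Let M := {p : V -> unitA | satisfies p S}.
Let P := powA M unitA.
(** The tautological assignment, whose coordinate at a model is that model. *)
Let generic (v : V) : P := fun m => proj1_sig m v.

Local Open Scope R_scope.

Lemma eval_generic t m : eval generic t m = eval (proj1_sig m) t.
Proof. exact: (@hom_eval V P unitA (fun a => a m)). Qed.

(* The condition [u j >= c for all j] cuts out an ideal of the power [P]. If it is
   proper, a homomorphism killing it composes with [generic] to a model violating
   the hypothesis; if not, [1] lies in it thanks to finitely many generators. *)
Lemma compactness (J : Type) (U : J -> Prop) (u : J -> term V) (c : R) : 0 < c <= 1 ->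
  (forall p : V -> unitA, satisfies p S -> exists2 j, U j & uval (eval p (u j)) = 0) ->
  exists2 js : seq J, (forall j, List.In j js -> U j) &
    forall p : V -> unitA, satisfies p S ->
      exists2 j, List.In j js & eval p (u j) < c.
Proof.
move=> c01 hu.
have [|tc _ hc] := @const_term V (fun _ => False) c; first lra.
pose G (a : P) := exists2 j, U j & a = eval generic (tominus tc (u j)).
have [G1|/exists_hom [h [hom hG]]] := classic (ideal G (one P)).
(* An element of the ideal is nonzero only at models where one of finitely many [u j] is below
   [c]. *)
- have H a : ideal G a -> exists2 js : seq J, (forall j, List.In j js -> U j) &
      forall m : M, a m <> zero ->
        exists2 j, List.In j js & eval (proj1_sig m) (u j) < c.
    elim=> {a} [|a [j Uj ->]|a b ab _ [js Ujs hjs]|a b _ [js Ujs hjs] _ [ks Uks hks]].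
    + by exists [::].
    + exists [:: j] => [k [<-|[]] //|m].
      rewrite eval_generic => h; exists j; first by left.
      apply: Rnot_le_lt => h'; apply: h; apply: uval_inj.
      by rewrite eval_tominus hc Rmax_left //; lra.
    + exists js => // m am; apply: hjs => bm; apply: am.
      have := congr1 (fun f => uval (f m)) ab; rewrite /= bm => e.
      by apply: uval_inj; move: e; have := uvalP (a m); rewrite /= /Rmin; case: Rle_dec; lra.
    + exists (js ++ ks) => [j hj|m abm].
        by case: (List.in_app_or _ _ _ hj) => [/Ujs|/Uks].
      have [am|/hjs [j hj ?]] := classic (a m = zero); last first.
        by exists j => //; apply/List.in_or_app; left.
      have [bm|/hks [j hj ?]] := classic (b m = zero); last first.
        by exists j => //; apply/List.in_or_app; right.
      by case: abm; rewrite /= am bm; apply: uval_inj; rewrite /= Rmin_right; lra.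
  have [js Ujs hjs] := H _ G1; exists js => // p hp; apply: (hjs (exist _ p hp)).
  by move=> /(congr1 uval) /=; lra.
- pose p v := h (generic v).
  have hp t : eval p t = h (eval generic t) by rewrite hom_eval.
  have [|j Uj hj] := hu p.
    move=> s t st; rewrite !hp; congr h; apply: functional_extensionality => m.
    by rewrite !eval_generic; exact: (proj2_sig m).
  have /(congr1 uval) : eval p (tominus tc (u j)) = zero.
    by rewrite hp; apply: hG; exists j.
  by rewrite eval_tominus hc hj Rmax_right /=; lra.
Qed.

End Compactness.

(** * From implicit definability to a defining term over [0,1] *)

Section Definability.
Variables (V : eqType) (X : V -> Prop) (y : V) (S : theory V).
Implicit Types p q : V -> unitA.

Hypothesis Xy : ~ X y.
Hypothesis fresh : exists w : V, ~ X w /\ w <> y.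
Hypothesis Svars : forall s t v, S (s, t) -> occurs v s \/ occurs v t -> X v \/ v = y.
Hypothesis impl : implicitly_defines S y.

Local Open Scope R_scope.

(** Both models fit into one assignment that follows [p] but stores [q y] at a fresh [w]: it
    satisfies [S] as [p] does and the renamed copy as [q] does. Implicit definability is then
    applied with [w] for z. *)
Lemma models_agree p q : satisfies p S -> satisfies q S ->
  (forall x, X x -> p x = q x) -> p y = q y.
Proof.
move=> hp hq pq; have [w [Xw wy]] := fresh.
pose f v := if v == w then q y else p v.
have fX v : X v -> f v = p v.
  by rewrite /f; case: eqP => // ->.
have fy : f y = p y by rewrite /f; case: eqP => // e; case: wy.
have := @impl w unitA f; rewrite /= fy {2}/f eqxx; apply.
move=> s t [st|[s' [t' [st [-> ->]]]]].
- have e r : (forall v, occurs v r -> X v \/ v = y) -> eval f r = eval p r.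
    by move=> h; apply: eval_ext => v /h [/fX|->].
  by rewrite !e; [exact: hp | |] => v hv; apply: (Svars st); [right|left].
- have e r : (forall v, occurs v r -> X v \/ v = y) ->
      eval f (rename (subst_var y w) r) = eval q r.
    move=> h; rewrite eval_rename; apply: eval_ext => v /h; rewrite /subst_var.
    by case: eqP => [->|vy] [Xv|] //; [rewrite /f eqxx | rewrite fX // pq].
  by rewrite !e; [exact: hq | |] => v hv; apply: (Svars st); [right|left].
Qed.

Lemma interpolate_models p q : satisfies p S -> satisfies q S ->
  exists2 t, over X t & uval (eval p t) = p y /\ uval (eval q t) = q y.
Proof.
move=> hp hq.
have [e|ne] := classic (p y = q y).
  have [t ot ht] := const_term X (uvalP (p y)).
  by exists t => //; rewrite !ht e.
apply: interpolate; apply: NNPP => h; apply: ne.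
apply: models_agree => // x Xx; apply: NNPP => hx; apply: h; by exists x.
Qed.

(** For fixed [p], interpolation gives at each model [q] a term exact at both. By compactness
    finitely many such terms come within [c] of [y] from below everywhere, and so does their
    join. *)
Lemma approx_below c p : 0 < c <= 1 -> satisfies p S ->
  exists t, [/\ over X t, eval p t <= p y &
    forall q, satisfies q S -> q y - eval q t < c].
Proof.
move=> c01 hp.
have [|ts Uts hts] := @compactness V S _ (fun t => over X t /\ eval p t <= p y)
    (fun t => tominus (TVar y) t) c c01.
  move=> q hq; have [t ot [tp tq]] := interpolate_models hp hq.
  exists t; first by split=> //; lra.
  by rewrite eval_tominus /= tq Rmax_left //; lra.
exists (tbigjoin ts); split.
- by apply: over_tbigjoin => t /Uts [].
- by apply: eval_tbigjoin_le => [|t /Uts []]; first case: (uvalP (p y)).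
- move=> q /hts [t tts]; rewrite eval_tominus => ht.
  have {}ht : Rmax 0 (q y - eval q t) < c := ht.
  have := eval_tbigjoin_ge q tts; have := Rmax_r 0 (q y - eval q t); lra.
Qed.

(** Dually, now varying [p]: the meet of finitely many terms from [approx_below] is also nowhere
    more than [c] above [y]. *)
Lemma approx c : 0 < c <= 1 -> exists2 t, over X t &
  forall p, satisfies p S -> Rabs (eval p t - p y) <= c.
Proof.
move=> c01.
have [|ts Uts hts] := @compactness V S _
    (fun t => over X t /\ forall q, satisfies q S -> q y - eval q t < c)
    (fun t => tominus t (TVar y)) c c01.
  move=> p hp; have [t [ot tp ht]] := approx_below c01 hp.
  by exists t => //; rewrite eval_tominus; exact/Rmax_left/Rle_minus.
exists (tbigmeet ts) => [|p hp]; first by apply: over_tbigmeet => t /Uts [].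
apply: Rabs_le; split.
- have : p y - c <= eval p (tbigmeet ts); last lra.
  apply: eval_tbigmeet_ge => [|t /Uts [_ /(_ p hp)]]; last lra.
  by have := uvalP (p y); lra.
- have [t tts] := hts p hp; rewrite eval_tominus => ht.
  have {}ht : Rmax 0 (eval p t - p y) < c := ht.
  have := eval_tbigmeet_le p tts; have := Rmax_r 0 (eval p t - p y); lra.
Qed.

(** Uniform limits, on the models, of terms over [X]; the bounds let such functions serve as tails
    in [dsum_unique]. *)
Definition approximable (g : (V -> unitA) -> R) : Prop :=
  (forall p, satisfies p S -> 0 <= g p <= 1) /\
  forall c, 0 < c <= 1 -> exists2 t, over X t &
    forall p, satisfies p S -> Rabs (eval p t - g p) <= c.

(** If [s] is within 1/4 of [g], then [s ⊖ 1/4] lies between g - 1/2 and g, so subtracting its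
    truncated double from 2g leaves a value in [0,1]. *)
Lemma approximable_step g : approximable g ->
  exists2 t, over X t & approximable (fun p => 2 * g p - eval p t).
Proof.
move=> [g01 ga].
have [|s os hs] := ga (/ 4); first lra.
have [|q oq hq] := @const_term V X (/ 4); first lra.
pose u := tominus s q; pose t := TOplus u u.
have ot : over X t by apply: over_oplus; exact: over_tominus.
have r01 p : satisfies p S -> 0 <= 2 * g p - eval p t <= 1.
  move=> hp; have /Rabs_le_between := hs p hp; have := g01 p hp.
  rewrite /t eval_oplus /u eval_tominus hq /Rmin /Rmax.
  by do 2?case: Rle_dec; lra.
exists t => //; split=> // c c01.
have [|s' os' hs'] := ga (c / 2); first lra.
have [||h oh hh] := @scale_term V X (/ 2) t => //; first lra.
(* The new function is 2(g - t/2), so an error c/2 on [g] becomes [c]. *)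
pose w := tominus s' h.
exists (TOplus w w); first by apply: over_oplus; exact: over_tominus.
move=> p hp; have /Rabs_le_between := hs' p hp; have := r01 p hp.
rewrite eval_oplus /w eval_tominus hh => r1 r2; apply: Rabs_le.
by rewrite /Rmin /Rmax; do 2?case: Rle_dec; lra.
Qed.

(** Iterating the step yields one sequence of terms, chosen for all models at once, whose remainders
    satisfy the recursion of δ. *)
Lemma approximable_term g : approximable g ->
  exists2 t, over X t & forall p, satisfies p S -> uval (eval p t) = g p.
Proof.
move=> ga.
have next (a : {g | approximable g}) : exists t, over X t /\
    approximable (fun p => 2 * proj1_sig a p - eval p t).
  by have [t] := approximable_step (proj2_sig a); exists t.
pose nt a := constructive_indefinite_description _ (next a).
pose F a : {g | approximable g} := exist _ _ (proj2 (proj2_sig (nt a))).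
pose a_ n := iter n F (exist _ g ga).
exists (TDelta (fun n => proj1_sig (nt (a_ n)))).
  by apply: over_delta => n; exact: (proj1 (proj2_sig (nt (a_ n)))).
move=> p hp; apply: (@dsum_unique (fun n => proj1_sig (a_ n) p)) => n.
  exact: (proj1 (proj2_sig (a_ n)) p hp).
pose r := proj1_sig (a_ n) p; pose x := uval (eval p (proj1_sig (nt (a_ n)))).
by change (r = x / 2 + (2 * r - x) / 2); lra.
Qed.

End Definability.

(** [hvars] renders the notation Σ(x,y), and [hfresh] provides a variable to serve as z. *)
Theorem mainTheorem10 (V : eqType) (X : V -> Prop) (y : V) (S : theory V)
  (hy : ~ X y)
  (hfresh : exists w : V, ~ X w /\ w <> y)
  (hvars : forall s t v, S (s, t) -> occurs v s \/ occurs v t -> X v \/ v = y) :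
  implicitly_defines S y -> explicitly_defines X S y.
Proof.
move=> impl.
have [|s os hs] := @approximable_term V X S (fun p => uval (p y)).
  split=> [p _|c c01]; first exact: uvalP.
  exact: approx.
exists s; split=> // A f hf /=.
have zero_at (h : A -> unitA) : is_hom h -> h (f y) = h (eval f s).
  move=> hom; apply: uval_inj; rewrite hom_eval // hs // => t t' /hf e.
  by rewrite -!hom_eval // e.
(* Every homomorphism to [0,1] kills both differences, which are therefore zero by [semisimple]. *)
apply: mle_anti; apply/mle_ominus0; apply: NNPP => /semisimple [h hom]; apply;
  by rewrite hom_ominus // zero_at // ominusxx.
Qed.
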